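(* Let $G$ be a subgroup of $\mathbb{Z}^{\mathbb{N}}$. The following conditions are equivalent: (1) $G$ is Menger-bounded. (2) For each strictly increasing $h\in\mathbb{N}^{\mathbb{N}}$ there is $f\in\mathbb{N}^{\mathbb{N}}$ such that for every $g\in G$ there exists $n$ such that $|g(k)|\le f(n)$ for all $k\in[0,h(n))$. (3) For each strictly increasing $h\in\mathbb{N}^{\mathbb{N}}$ there is $f\in\mathbb{N}^{\mathbb{N}}$ such that for every $g\in G$ there exist infinitely many $n$ such that $|g(k)|\le f(n)$ for all $k\in[0,h(n))$. (4) There is $f\in\mathbb{N}^{\mathbb{N}}$ such that for every $g\in G$ there exist infinitely many $n$ such that $|g(k)|\le f(n)$ for all $k\in[0,n)$.
   Context: $\mathbb{N}=\{0,1,2,\dots\}$, and $[0,m)=\{0,1,\dots,m-1\}$. The group $\mathbb{Z}^{\mathbb{N}}$ (the Baer-Specker group) carries pointwise addition and the product topology ($\mathbb{Z}$ discrete); subgroups carry the subspace topology. A topological group $(G,\cdot)$ is Menger-bounded if for each sequence $(U_n)_{n\in\mathbb{N}}$ of neighborhoods of the unit of $G$ there exist finite sets $F_n\subseteq G$, $n\in\mathbb{N}$, such that $G=\bigcup_n F_n\cdot U_n$, where $A\cdot B=\{a\cdot b: a\in A,\ b\in B\}$. *)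

(* Defs.v *)
From HB Require Import structures.
From mathcomp Require Import all_boot all_order all_algebra.
From mathcomp Require Import all_classical all_reals all_analysis.

Set Implicit Arguments.
Unset Strict Implicit.
Unset Printing Implicit Defensive.

Import GRing.Theory.

Local Open Scope classical_set_scope.
Local Open Scope ring_scope.

(* The neighborhoods range over arbitrary (not only open) sets, and "+" is the
   group law: the library's topological groups are written additively. *)
Definition menger_bounded (M : topologicalZmodType) : Prop :=
  forall U : nat -> set M, (forall n, nbhs (0 : M) (U n)) ->
  exists F : nat -> set M, (forall n, finite_set (F n)) /\
    [set: M] = \bigcup_n [set a + u | a in F n & u in U n].

(* [int] has no topology in the library; it gets the discrete one. *)
HB.instance Definition _ := hasNbhs.Build int principal_filter.
HB.instance Definition _ := Discrete_ofNbhs.Build int erefl.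

(* The library's product topology on [nat -> int], with the library's
   pointwise addition on functions. *)
Definition baer_specker : Type := {ptws nat -> int}.

HB.instance Definition _ := Topological.on baer_specker.
HB.instance Definition _ := GRing.Zmodule.copy baer_specker (nat -> int).

Fact baer_specker_sub_continuous :
  continuous (fun x : baer_specker * baer_specker => x.1 - x.2).
Proof.
move=> x; apply/cvg_sup => i V [W [[B _ <-] Bxi BV]].
have near_coord (y : baer_specker) : \forall z \near y, z i = y i.
  exact: (@proj_continuous nat (fun=> int) i y _ (discrete_set1 (y i))).
change (\forall z \near x, V (z.1 - z.2)); near=> z; apply: BV.
change (B (z.1 i - z.2 i)); suff [-> ->] : z.1 i = x.1 i /\ z.2 i = x.2 i by [].
by split; near: z; [exact: cvg_fst (near_coord _)|exact: cvg_snd (near_coord _)].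
Unshelve. all: by end_near. Qed.

HB.instance Definition _ :=
  PreTopologicalNmodule_isTopologicalZmodule.Build baer_specker
    baer_specker_sub_continuous.

(* [set_type A], the sigma type of the elements of [A], carries the subspace
   topology in the library; the proof that [A] is a subgroup is what gives it
   a group structure. *)
Definition subgroup (M : topologicalZmodType) (A : set M)
  of zmod_closed (mem A) : Type := set_type A.

Section Subgroup.
Variables (M : topologicalZmodType) (A : set M) (cA : zmod_closed (mem A)).

HB.instance Definition _ := Topological.copy (subgroup cA) (set_type A).
HB.instance Definition _ := SubChoice.copy (subgroup cA) (set_type A).
HB.instance Definition _ :=
  GRing.SubChoice_isSubZmodule.Build M (mem A) (subgroup cA) cA.

Fact subgroup_sub_continuous :
  continuous (fun x : subgroup cA * subgroup cA => x.1 - x.2).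
Proof.
move=> x V [W [[B oB <-] Bx BV]].
have val_cts : continuous (val : subgroup cA -> M).
  exact: (@initial_continuous (set_type A) M set_val).
suff : \forall z \near x, B (val (z.1 - z.2)) by apply: filterS => z; exact: BV.
have : B (val x.1 - val x.2) by rewrite -raddfB.
move=> /(conj oB)/open_nbhs_nbhs Bnear.
have cv : ((fun z : subgroup cA * subgroup cA => (val z.1, val z.2)) @ x
    --> (val x.1, val x.2)).
  apply: cvg_pair.
    exact: (@continuous_comp _ _ _ fst (val : subgroup cA -> M) x cvg_fst
      (val_cts x.1)).
  exact: (@continuous_comp _ _ _ snd (val : subgroup cA -> M) x cvg_snd
      (val_cts x.2)).
have Bsub := @sub_continuous M (val x.1, val x.2) B Bnear.
have BC : \forall z \near x, B (val z.1 - val z.2) := cv _ Bsub.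
by apply: filterS BC => z; rewrite raddfB.
Qed.

HB.instance Definition _ :=
  PreTopologicalNmodule_isTopologicalZmodule.Build (subgroup cA)
    subgroup_sub_continuous.

End Subgroup.

(* Main.v *)
(* A subset of G is a neighborhood of 0 exactly when it contains, for some m,
   all elements of G vanishing on [0, m).  Hence (1) -> (2): with U_n the
   elements vanishing on [0, h n), let f n bound the entries on [0, h n) of the
   finite set F_n.  For (2) -> (3), apply (2) to every shift n |-> h (n + m) and
   take a diagonal maximum.  (3) -> (4) is h = id.  For (4) -> (1), let
   h n >= n be such that vanishing on [0, h n) implies membership in U_n, and
   let F_n contain, for every N < h (n + 1), a representative in G of each
   restriction to [0, N) bounded by f N.  If |g| <= f N on [0, N) and h 0 <= N,
   take the least n with N < h (n + 1): then h n <= N, so g differs by an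
   element of U_n from its representative in F_n. *)
Require Import Defs.
From mathcomp Require Import all_boot all_order all_algebra.
From mathcomp Require Import all_classical all_reals all_analysis.
From mathcomp Require Import zify.

Set Implicit Arguments.
Unset Strict Implicit.
Unset Printing Implicit Defensive.

Import Order.TTheory GRing.Theory Num.Theory.

Local Open Scope classical_set_scope.
Local Open Scope ring_scope.

Lemma infinite_set_natP (A : set nat) :
  infinite_set A <-> forall m, exists n, (m <= n)%N /\ A n.
Proof.
split=> [Ainf m|Aunb finA].
  apply: contrapT => /forallNP noA; apply: Ainf.
  apply: sub_finite_set (finite_II m) => n An /=.
  by rewrite ltnNge; apply/negP => mn; exact: (noA n).
have [s As] := (finite_seqP A).1 finA.
have [n []] := Aunb (\max_(i <- s) i).+1.
rewrite As => /[swap] /= sn; rewrite ltnNge.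
by rewrite (leq_bigmax_seq (F := fun i : nat => i) n).
Qed.

Section BaerSpeckerSubgroup.
Variables (G : set baer_specker) (subG : GRing.zmod_closed (mem G)).

Let coord (g : subgroup subG) : nat -> int := val g.

Lemma coordB (a b : subgroup subG) k : coord (a - b) k = coord a k - coord b k.
Proof. by rewrite /coord raddfB. Qed.

(** Each coordinate map is continuous into the discrete integers, so vanishing at one index holds
    near 0; finitely many such conditions are intersected. *)
Lemma nbhs0_vanish (m : nat) :
  nbhs (0 : subgroup subG) [set g | forall k, (k < m)%N -> coord g k = 0].
Proof.
have coord0 (i : 'I_m) : \forall g \near (0 : subgroup subG), coord g i = 0.
  have val_cts : continuous (val : subgroup subG -> baer_specker).
    exact: (@initial_continuous (set_type G) baer_specker set_val).
  have near0 : \forall z \near (0 : baer_specker), z (i : nat) = 0.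
    exact: (@proj_continuous nat (fun=> int) i (0 : baer_specker) _
      (discrete_set1 _)).
  have vnear0 : \forall z \near val (0 : subgroup subG),
    (z : baer_specker) (i : nat) = 0 by rewrite raddf0.
  exact: val_cts vnear0.
have near0 := filter_forall (nbhs_filter (0 : subgroup subG)) coord0.
apply: (@filterS _ _ (nbhs_filter (0 : subgroup subG)) _ _ _ near0).
by move=> g g0 k km; exact: (g0 (Ordinal km)).
Qed.

(** Otherwise each m gives some [u m] outside [U] that vanishes on [0, m). These elements converge
    to 0 coordinatewise, hence eventually enter [U], a contradiction. *)
Lemma nbhs0_contains_vanish (U : set (subgroup subG)) : nbhs 0 U ->
  exists m, [set g | forall k, (k < m)%N -> coord g k = 0] `<=` U.
Proof.
move=> [_ [[B oB <-] B0 BU]]; apply: contrapT => /forallNP noU.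
have /choice[u uP] m : exists g : subgroup subG,
    (forall k, (k < m)%N -> coord g k = 0) /\ ~ U g.
  apply: contrapT => /forallNP nog; apply: (noU m) => g g0.
  by apply: contrapT => nUg; exact: (nog g).
have ucvg : (fun m => val (u m) : baer_specker) @ \oo --> (0 : baer_specker).
  apply/cvg_sup => i V [W [[C _ <-] Ci CV]].
  exists i.+1 => // m /= im; apply: CV => /=.
  by have := (uP m).1 i im; rewrite /coord => ->.
have Bval0 : B (val (0 : subgroup subG)) by [].
rewrite raddf0 in Bval0.
have [m _ /(_ m (leqnn m))Bu] := ucvg _ (open_nbhs_nbhs (conj oB Bval0)).
by apply: (uP m).2; exact: BU.
Qed.

(** Only finitely many patterns on [0, m) have entries in [-b, b]; one element of the subgroup is
    chosen for each pattern that occurs there. *)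
Lemma finite_representatives (m b : nat) :
  exists F : set (subgroup subG), finite_set F /\
    forall g, (forall k, (k < m)%N -> `|coord g k| <= b%:Z) ->
      exists2 a, F a & forall k, (k < m)%N -> coord a k = coord g k.
Proof.
(* The shift by b encodes a value in [-b, b] as a number in [0, 2b]. *)
pose S (c : {ffun 'I_m -> 'I_(b.*2.+1)}) :=
  [set g : subgroup subG | forall i : 'I_m, coord g i = (c i)%:Z - b%:Z].
(* A pattern realised by no element of the subgroup gets the default 0, which only adds a harmless
   element. *)
exists (range (fun c => xget 0 (S c))); split.
  by apply: finite_image; exact: finite_finset.
move=> g gb; pose c := [ffun i : 'I_m => inord `|coord g i + b%:Z|]
  : {ffun 'I_m -> 'I_(b.*2.+1)}.
have Sg : S c g.
  move=> i; have gi := gb i (ltn_ord i).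
  by rewrite ffunE inordK; lia.
exists (xget 0 (S c)); first by exists c.
move=> k km; have Sx := xgetPex 0 (ex_intro _ g Sg).
by rewrite (Sx (Ordinal km)) (Sg (Ordinal km)).
Qed.

Lemma menger_bounded_dominated : menger_bounded (subgroup subG) ->
  forall h : nat -> nat, exists f : nat -> nat, forall g, G g ->
    exists n, forall k, (k < h n)%N -> `|g k| <= (f n)%:Z.
Proof.
move=> mG h; have [F [finF coverF]] := mG _ (fun n => nbhs0_vanish (h n)).
have /choice[f fP] n : exists b : nat, forall a, F n a ->
    forall k, (k < h n)%N -> `|coord a k| <= b%:Z.
  have /finite_seqP[s Fs] := finF n.
  exists (\max_(a <- s) \max_(k < h n) `|coord a k|%N) => a.
  rewrite Fs => /= sa k kh; rewrite -abszE lez_nat.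
  apply: leq_trans (leq_bigmax_seq
    (F := fun a => \max_(k < h n) `|coord a k|%N) a sa isT).
  exact: (leq_bigmax (Ordinal kh)).
exists f => g Gg.
pose g' : subgroup subG := exist _ g (mem_set Gg).
have : [set: subgroup subG] g' by [].
rewrite coverF => -[n _ [a Fa [u u0 aug]]]; exists n => k kh.
have -> : g k = coord a k; last exact: fP.
have <- : coord g' k = g k by [].
by rewrite -aug /coord raddfD -[RHS]addr0 -(u0 k kh).
Qed.

Lemma dominated_menger_bounded (f : nat -> nat) :
  (forall g, G g ->
    infinite_set [set n | forall k, (k < n)%N -> `|g k| <= (f n)%:Z]) ->
  menger_bounded (subgroup subG).
Proof.
move=> fP U nU.
have /choice[m mU] n := nbhs0_contains_vanish (nU n).
have /choice[R RP] n := finite_representatives n (f n).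
(* The summand [m n] makes vanishing on [0, [h n]) imply membership in [U n]; the summand [n] makes
   [h] unbounded, so every [N] lies below some [h n.+1]. *)
pose h n := (n + m n)%N.
exists (fun n => \bigcup_(N in `I_(h n.+1)) R N); split.
  move=> n; apply: bigcup_finite; first exact: finite_II.
  by move=> N _; have [] := RP N.
apply/esym/seteqP; split=> // g _.
have [N [hN gN]] := (infinite_set_natP _).1 (fP _ (set_valP g)) (h 0).
have [a Ra ag] := (RP N).2 g gN.
have exn : exists n, (N < h n.+1)%N by exists N; rewrite /h; lia.
have [n Nh nmin] := ex_minnP exn.
have hn : (h n <= N)%N.
  (* For [n = 0] this is the choice of [N] above [h 0]; otherwise it is the minimality of [n]. *)
  case: n nmin {Nh} => // n nmin; rewrite leqNgt; apply/negP => /nmin.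
  by rewrite ltnn.
exists n => //; exists a; first by exists N.
exists (g - a); last by rewrite addrC subrK.
apply: mU => k km; rewrite coordB ag ?subrr//.
by apply: leq_trans hn; rewrite /h; lia.
Qed.

End BaerSpeckerSubgroup.

Lemma dominated_infinitely_often (G : set baer_specker) :
  (forall h : nat -> nat, {homo h : m n / (m < n)%N} ->
    exists f : nat -> nat, forall g, G g ->
      exists n, forall k, (k < h n)%N -> `|g k| <= (f n)%:Z) ->
  forall h : nat -> nat, {homo h : m n / (m < n)%N} ->
    exists f : nat -> nat, forall g, G g ->
      infinite_set [set n | forall k, (k < h n)%N -> `|g k| <= (f n)%:Z].
Proof.
move=> dom h hinc.
have /choice[f fP] m : exists f : nat -> nat, forall g, G g ->
    exists n, forall k, (k < h (n + m))%N -> `|g k| <= (f n)%:Z.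
  by apply: (dom (fun n => h (n + m)%N)) => i j ij; apply: hinc; lia.
(* If the shift by [m] succeeds at [n], then [N = n + m] works for [h]: the maximum at [N] includes
   [f m n], and [N] is at least the arbitrary [m]. *)
exists (fun N => \max_(m < N.+1) f m (N - m)%N) => g Gg.
apply/infinite_set_natP => m.
have [n gn] := fP m g Gg; exists (n + m)%N; split; first by lia.
move=> k /gn /le_trans; apply; rewrite lez_nat.
have mlt : (m < (n + m).+1)%N by lia.
have := leq_bigmax (F := fun i : 'I_(n + m).+1 => f i (n + m - i)%N)
  (Ordinal mlt).
by rewrite /= addnK.
Qed.

Theorem theorem3p1 (G : set baer_specker) (subG : GRing.zmod_closed (mem G)) :
  [<-> menger_bounded (subgroup subG);
       forall h : nat -> nat, {homo h : m n / (m < n)%N} ->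
         exists f : nat -> nat, forall g, G g ->
           exists n, forall k, (k < h n)%N -> `|g k| <= (f n)%:Z;
       forall h : nat -> nat, {homo h : m n / (m < n)%N} ->
         exists f : nat -> nat, forall g, G g ->
           infinite_set [set n | forall k, (k < h n)%N -> `|g k| <= (f n)%:Z];
       exists f : nat -> nat, forall g, G g ->
         infinite_set [set n | forall k, (k < n)%N -> `|g k| <= (f n)%:Z]].
Proof.
tfae.
- by move=> /menger_bounded_dominated dom h _; exact: dom.
- exact: dominated_infinitely_often.
- by apply; [] => m n.
- by move=> [f]; exact: dominated_menger_bounded.
Qed.
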